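(* Let $p$ be a prime and let $q$ be an odd power of $p$ (that is, $q=p^{2r+1}$ for some integer $r\ge 0$). Let $S \subseteq \mathbb{F}_q^*$ with $S=-S$ be such that $S/S \neq \mathbb{F}_q^*$. Then $$\omega(\operatorname{Cay}(\mathbb{F}_q^+;S))< \sqrt{|S/S|}+1 \quad\text{if } q=p,$$ and $$\omega(\operatorname{Cay}(\mathbb{F}_q^+;S))< \sqrt{|S/S|}+\sqrt{q/p}-1 \quad\text{if } q\neq p.$$
   Context: $\mathbb{F}_q$ is the finite field with $q$ elements, $\mathbb{F}_q^+$ its additive group, and $\mathbb{F}_q^*=\mathbb{F}_q\setminus\{0\}$. For $S\subseteq \mathbb{F}_q^*$, $-S=\{-s: s\in S\}$ and $S/S=\{a/b: a,b\in S\}$. For $S=-S$, the Cayley graph $\operatorname{Cay}(\mathbb{F}_q^+;S)$ is the (undirected) graph with vertex set $\mathbb{F}_q$ in which two vertices are adjacent if and only if their difference lies in $S$. The clique number $\omega(X)$ of a graph $X$ is the maximum number of vertices of a complete subgraph of $X$.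
   Formalization: The first bound assumes S is nonempty, and the second assumes |S| ≥ 2 when q = 8; in exactly these excluded cases (S empty with q = p; |S| ≤ 1 with q = 8) the strict inequality fails with equality. *)

(* Defs.v *)
From HB Require Import structures.
From mathcomp Require Import all_boot all_order all_algebra.

Set Implicit Arguments.
Unset Strict Implicit.
Unset Printing Implicit Defensive.

Import GRing.Theory.
Local Open Scope ring_scope.

(* A graph on a finite type is given by its adjacency relation. *)
Definition is_clique (T : finType) (e : rel T) (A : {set T}) : bool :=
  [forall x in A, forall y in A, (x != y) ==> e x y].

Definition clique_number (T : finType) (e : rel T) : nat :=
  \max_(A : {set T} | is_clique e A) #|A|.

Definition cayley (V : finZmodType) (S : {set V}) : rel V :=
  fun x y => x - y \in S.

Definition opp_set (V : finZmodType) (S : {set V}) : {set V} :=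
  [set - s | s in S].

Definition ratio_set (F : finFieldType) (S : {set F}) : {set F} :=
  [set a / b | a in S, b in S].

Definition nonzero_set (F : finFieldType) : {set F} := [set x | x != 0].

Lemma cayley_irreflexive (F : finFieldType) (S : {set F}) :
  S \subset nonzero_set F -> irreflexive (cayley S).
Proof.
move=> /subsetP sS x; rewrite /cayley subrr; apply/negP => /sS.
by rewrite inE eqxx.
Qed.

Lemma cayley_symmetric (V : finZmodType) (S : {set V}) :
  S = opp_set S -> symmetric (cayley S).
Proof.
move=> hS x y; rewrite /cayley -(opprB y x) {1}hS.
by rewrite (mem_imset _ _ oppr_inj).
Qed.

(* Main.v *)
(* Let C be a clique of size n > 1, N = |S/S| and q = p^t. The directions
   determined by C x C, other than 0 and infinity, lie in S/S. By Redei's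
   method, reducing X^q modulo the Redei polynomial of C x C and specialising
   at the direction 0 gives a polynomial X^q - g divisible by
   (prod_(b in C) (X - b))^n with deg g <= N + 1. If g' <> 0, then
   (prod_(b in C) (X - b))^(n-1) divides g', whence n (n - 1) <= N. In general
   one first extracts a p^e-th root and gets n (n - p^e) + p^e <= N + 1 and
   n <= p^(t-e). For t = 2r + 1, either n <= p^r or e <= r, and both
   alternatives give the bound. *)
Require Import Defs.
From HB Require Import structures.
From mathcomp Require Import all_boot all_order all_algebra.
From mathcomp Require Import finfield.
From mathcomp Require Import zify ring.

Set Implicit Arguments.
Unset Strict Implicit.
Unset Printing Implicit Defensive.

Import GRing.Theory Num.Theory.
Local Open Scope ring_scope.

(** * Root multiplicities, derivatives and [p]-th powers of polynomials *)

Lemma dvdp_deriv_XsubC_exp (F : fieldType) (x : F) (a : nat) (Q : {poly F}) :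
  ('X - x%:P) ^+ a %| Q -> ('X - x%:P) ^+ a.-1 %| Q^`().
Proof.
case/dvdpP=> h ->; rewrite derivM deriv_exp dvdp_add //.
  by rewrite dvdp_mull // dvdp_exp2l // leq_pred.
by rewrite mulrnAr -mulr_natl !dvdp_mull.
Qed.

Lemma dvdp_prod_XsubC_exp (F : fieldType) (s : seq F) (a : nat)
    (Q : {poly F}) :
  uniq s -> (forall x, x \in s -> ('X - x%:P) ^+ a %| Q) ->
  (\prod_(x <- s) ('X - x%:P)) ^+ a %| Q.
Proof.
move=> + sQ; elim: s sQ => [|x s IH] sQ /=; first by rewrite big_nil expr1n dvd1p.
case/andP=> xs us; rewrite big_cons exprMn Gauss_dvdp.
  by rewrite sQ ?mem_head // IH // => y ys; rewrite sQ // inE ys orbT.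
by rewrite coprimep_expl // coprimep_expr // coprimep_sym coprimep_XsubC root_prod_XsubC.
Qed.

Lemma leq_size_prod_exp (F : fieldType) (s : seq F) (a : nat) (Q : {poly F}) :
  uniq s -> Q != 0 -> (forall x, x \in s -> ('X - x%:P) ^+ a %| Q) ->
  (size s * a < size Q)%N.
Proof.
move=> us Q0 /(dvdp_prod_XsubC_exp us) /(dvdp_leq Q0).
have := size_exp (\prod_(x <- s) ('X - x%:P)) a.
rewrite size_prod_XsubC /= => <-; apply: leq_trans.
by rewrite prednK // size_poly_gt0 expf_neq0 // -size_poly_gt0 size_prod_XsubC.
Qed.

Lemma Frobenius_surj (F : finFieldType) (p : nat) (x : F) :
  p \in [pchar F] -> {y | y ^+ p = x}.
Proof.
move=> pF; have inj := fmorph_inj (pFrobenius_aut pF).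
by exists (invF inj x); rewrite -(pFrobenius_autE pF) f_invF.
Qed.

(** A zero derivative kills every coefficient of index prime to [p]. The remaining ones have [p]-th
    roots because Frobenius is bijective on [F], and these roots are the coefficients of [h]. *)
Lemma deriv_eq0_expp (F : finFieldType) (p : nat) (g : {poly F}) :
  p \in [pchar F] -> g^`() = 0 -> {h | h ^+ p = g}.
Proof.
move=> pF g'0; have p0 := prime_gt0 (pcharf_prime pF).
pose c i := sval (Frobenius_surj g`_(p * i) pF).
exists (\poly_(i < size g) c i).
have pPF : p \in [pchar {poly F}] by rewrite pchar_poly.
rewrite -(pFrobenius_autE pPF) poly_def raddf_sum /=.
apply/polyP => i; rewrite coef_sum.
under eq_bigr => j _.
  rewrite pFrobenius_autE exprZn (svalP (Frobenius_surj _ pF)) -exprM coefZ coefXn.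
  over.
have [/dvdnP[j ->]|pi] := boolP (p %| i)%N.
  have [jg|jg] := ltnP j (size g).
    rewrite (bigD1 (Ordinal jg)) //= eqxx mulr1 [(p * j)%N]mulnC big1 ?addr0 // => k kj.
    by rewrite eqn_pmul2r // eq_sym (negPf (kj : val k != j)) mulr0.
  rewrite big1 => [|k _]; last first.
    by rewrite eqn_pmul2r // gtn_eqF ?mulr0 // (leq_trans (ltn_ord k)).
  by rewrite nth_default // (leq_trans jg) // leq_pmulr.
rewrite big1 => [|k _]; last first.
  by case: eqP pi => [->|_ _]; rewrite ?mulr0 // dvdn_mull.
case: i pi => [|i] pi; first by rewrite dvdn0 in pi.
have := congr1 (fun h : {poly F} => h`_i) g'0; rewrite coef_deriv coef0 -mulr_natr.
by move/eqP; rewrite mulf_eq0 -(dvdn_pcharf pF) (negPf pi) orbF eq_sym => /eqP.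
Qed.

(** The multiplicity of [x] in [Q ^+ p] is [p] times that in [Q]; the two inequalities say that [b]
    is [a / p] rounded up. *)
Lemma XsubC_expp_dvdp (F : fieldType) (x : F) (a b p : nat) (Q : {poly F}) :
  (a <= p * b)%N -> (p * b < a + p)%N -> ('X - x%:P) ^+ a %| Q ^+ p ->
  ('X - x%:P) ^+ b %| Q.
Proof.
have [->|Q0] := eqVneq Q 0; first by rewrite dvdp0.
move=> ab ba; rewrite -!mup_geq ?expf_neq0 //.
have -> : mup x (Q ^+ p) = (p * mup x Q)%N.
  elim: p {ab ba} => [|p IH]; last by rewrite exprS mupM ?expf_neq0 // IH mulSn.
  by rewrite expr0 mupNroot // root1.
nia.
Qed.

(* If [g' = 0] then [X^q - g] is a [p]-th power, so one descends to
   [X^(q/p) - h] with [h^p = g]; the number of such steps is [e]. *)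
Lemma Xpow_sub_descent (F : finFieldType) (p t a M : nat) (g : {poly F})
    (s : seq F) :
  p \in [pchar F] -> uniq s -> (1 < size s)%N -> (0 < a)%N ->
  (size g <= M.+1)%N -> (M < p ^ t)%N ->
  (forall x, x \in s -> ('X - x%:P) ^+ a %| 'X^(p ^ t) - g) ->
  exists e, [/\ (e < t)%N, (size s <= p ^ (t - e))%N
              & (size s * (a - p ^ e) + p ^ e <= M)%N].
Proof.
move=> pF us s1; have pp := pcharf_prime pF; have p0 := prime_gt0 pp.
elim: t a M g => [|t IH] a M g a0 gM Mt sg.
  (* For [t = 0], [g] is constant, so ['X - g] has degree 1 and cannot have the at least two roots
     in [s]. *)
  have gX : (size g < size ('X^1 : {poly F}))%N by rewrite size_polyXn (leq_ltn_trans gM).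
  have sQ : size ('X^(p ^ 0) - g) = 2%N.
    by rewrite expn0 size_polyDl ?size_polyXn // size_polyN -(size_polyXn F 1).
  have Q0 : 'X^(p ^ 0) - g != 0 by rewrite -size_poly_gt0 sQ.
  by have := leq_size_prod_exp us Q0 sg; rewrite sQ ltnNge (leq_mul s1 a0).
have sQ : size ('X^(p ^ t.+1) - g) = (p ^ t.+1).+1.
  by rewrite size_polyDl ?size_polyXn // size_polyN ltnS (leq_trans gM).
have Q0 : 'X^(p ^ t.+1) - g != 0 by rewrite -size_poly_gt0 sQ.
have [g'0|g'0] := eqVneq g^`() 0.
  have [h hg] := deriv_eq0_expp pF g'0.
  have Qh : 'X^(p ^ t.+1) - g = ('X^(p ^ t) - h) ^+ p.
    have pPF : p \in [pchar {poly F}] by rewrite pchar_poly.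
    by rewrite -(pFrobenius_autE pPF) raddfB /= !pFrobenius_autE hg -exprM expnSr.
  have hM : (size h <= (M %/ p).+1)%N.
    have := size_exp h p; rewrite hg => gh.
    by rewrite -add1n -leq_subLR subn1 leq_divRL // -gh -subn1 leq_subLR.
  have Mt' : (M %/ p < p ^ t)%N by rewrite ltn_divLR // -expnSr.
  (* [b] is [a / p] rounded up, the multiplicity that survives extraction of the [p]-th root. *)
  pose b := (a %/ p + (a %% p != 0))%N.
  have ab : (a <= p * b)%N.
    rewrite {1}(divn_eq a p) mulnDr mulnC leq_add2l.
    by have := ltn_pmod a p0; case: eqP; lia.
  have ba : (p * b < a + p)%N.
    rewrite {1}(divn_eq a p) mulnDr mulnC -addnA ltn_add2l.
    by case: eqP; lia.
  have b0 : (0 < b)%N by nia.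
  have sh x : x \in s -> ('X - x%:P) ^+ b %| 'X^(p ^ t) - h.
    by move=> xs; apply: (XsubC_expp_dvdp ab ba); rewrite -Qh sg.
  have [e [et se eM]] := IH _ _ _ b0 hM Mt' sh.
  exists e.+1; split; rewrite ?subSS //.
  (* Multiplying the inductive inequality by [p] and using [a <= p * b] gives the claim for
     [e.+1]. *)
  have : (p * (size s * (b - p ^ e) + p ^ e) <= M)%N.
    by rewrite mulnC -leq_divRL.
  apply: leq_trans; rewrite mulnDr -expnS leq_add2r mulnCA leq_mul2l mulnBr.
  by rewrite -expnS leq_sub2r ?orbT.
exists 0%N; split => //.
  have := leq_size_prod_exp us Q0 sg; rewrite sQ subn0 ltnS.
  by apply: leq_trans; rewrite leq_pmulr.
have s' x : x \in s -> ('X - x%:P) ^+ a.-1 %| g^`().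
  move=> /sg /dvdp_deriv_XsubC_exp; rewrite derivB derivXn -mulr_natr.
  by rewrite expnS natrM pcharf0 ?pchar_poly // mul0r mulr0 sub0r dvdpNr.
have := leq_size_prod_exp us g'0 s'.
have g0 : g != 0 by apply: contraNneq g'0 => ->; rewrite deriv0.
have := lt_size_deriv g0; rewrite expn0 addn1 subn1 => gg' sg'.
by rewrite -ltnS (leq_trans _ gM) // (leq_ltn_trans sg').
Qed.

(** * Sizes of ratio sets *)

Lemma card_ratio_set (F : finFieldType) (S : {set F}) :
  S != set0 -> S \subset nonzero_set F -> (#|S| <= #|ratio_set S|)%N.
Proof.
case/set0Pn=> s0 s0S /subsetP S0.
have s0n0 : s0 != 0 by have := S0 _ s0S; rewrite inE.
rewrite -(card_imset _ (mulIf (invr_neq0 s0n0))); apply/subset_leq_card/subsetP.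
by move=> _ /imsetP[s sS ->]; apply/imset2P; exists s s0.
Qed.

(** Besides 0, some nonzero element is missed. This keeps the degree of the lacunary remainder [g]
    below that of ['X^#|F|]. *)
Lemma card_ratio_set_lt (F : finFieldType) (S : {set F}) :
  S \subset nonzero_set F -> ratio_set S != nonzero_set F ->
  (#|ratio_set S|.+1 < #|F|)%N.
Proof.
move=> /subsetP S0 SF.
have RF : ratio_set S \proper nonzero_set F.
  rewrite properEneq SF; apply/subsetP => _ /imset2P[a b /S0 + /S0 + ->].
  by rewrite !inE => a0 b0; rewrite mulf_neq0 ?invr_neq0.
have F0 : nonzero_set F = ~: [set 0] by apply/setP => x; rewrite !inE.
have := cardsC [set (0 : F)]; rewrite cards1 -F0 add1n => <-.
by rewrite ltnS proper_card.
Qed.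

(** * Total degree in two variables and the Redei polynomial; the inner variable is the direction *)

Definition tdeg_le (R : nzSemiRingType) (d : nat) (P : {poly {poly R}}) :=
  forall i j, (d < i + j)%N -> P`_i`_j = 0.

Lemma tdeg_le1 (R : nzSemiRingType) : tdeg_le 0 (1 : {poly {poly R}}).
Proof. by move=> [|i] [|j] //= _; rewrite coef1 /= ?coef1 ?coef0. Qed.

Lemma tdeg_leX (R : nzSemiRingType) : tdeg_le 1 ('X : {poly {poly R}}).
Proof.
move=> i j ij; rewrite coefX; case: eqP ij => [-> |_ _]; rewrite ?coef0 //.
by case: j => // j _; rewrite coef1.
Qed.

Lemma tdeg_leM (R : nzSemiRingType) (d e : nat) (P Q : {poly {poly R}}) :
  tdeg_le d P -> tdeg_le e Q -> tdeg_le (d + e) (P * Q).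
Proof.
move=> Pd Qe i j ij; rewrite coefM coef_sum big1 // => -[k /= ki] _.
rewrite coefM big1 // => -[l /= lj] _.
have [kl|kl] := ltnP d (k + l); first by rewrite Pd ?mul0r.
by rewrite Qe ?mulr0 //; lia.
Qed.

Lemma tdeg_leB (R : nzRingType) (d : nat) (P Q : {poly {poly R}}) :
  tdeg_le d P -> tdeg_le d Q -> tdeg_le d (P - Q).
Proof. by move=> Pd Qd i j ij; rewrite !coefB Pd // Qd // subrr. Qed.

Lemma tdeg_le_coefC (R : nzSemiRingType) (d k : nat) (P : {poly {poly R}}) :
  tdeg_le d P -> (k <= d)%N -> tdeg_le (d - k) (P`_k)%:P.
Proof.
move=> Pd kd [|i] j ij; rewrite coefC /= ?coef0 // Pd //; lia.
Qed.

Lemma tdeg_le_prod_XsubC (R : comNzRingType) (s : seq (R * R)) :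
  tdeg_le (size s) (\prod_(u <- s) ('X - (u.2%:P - u.1 *: 'X)%:P)).
Proof.
elim: s => [|u s IH] /=; first by rewrite big_nil; apply: tdeg_le1.
rewrite big_cons -add1n; apply: tdeg_leM IH; apply: tdeg_leB (@tdeg_leX R) _.
move=> [|i] [|[|j]] // ij; rewrite coefC ?coef0 //= coefB coefC coefZ coefX /=.
by rewrite mulr0 subr0.
Qed.

(** Division by a monic [H] whose total degree is its degree in the outer variable does not raise
    total degree: each step multiplies the remainder by ['X] and cancels its coefficient of index
    [k] with a multiple of [H]. *)
Lemma Xn_rem_tdeg_le (R : comNzRingType) (k m : nat) (H : {poly {poly R}}) :
  H \is monic -> size H = k.+1 -> tdeg_le k H -> (0 < k)%N ->
  exists2 r : {poly {poly R}}, tdeg_le m r /\ (size r <= k)%N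
    & exists h, 'X^m = h * H + r.
Proof.
move=> Hmon sH Hk k0; elim: m => [|m [r [rm rk] [h hr]]].
  exists 1; first by rewrite size_poly1; split => //; apply: tdeg_le1.
  by exists 0; rewrite mul0r add0r.
pose t := 'X * r; exists (t - (t`_k)%:P * H); last first.
  by exists ('X * h + (t`_k)%:P); rewrite exprS hr mulrDr mulrDl mulrA -addrA [_ + (t - _)]addrC subrK.
have tm : tdeg_le m.+1 t by rewrite -add1n; apply: tdeg_leM rm; apply: tdeg_leX.
have st : (size t <= k.+1)%N.
  by rewrite /t -commr_polyX (leq_trans (size_polyMleq _ _)) // size_polyX addn2.
split.
  apply: tdeg_leB => //; have [km|mk] := leqP k m.+1.
    by rewrite -{1}(subnK km); apply: tdeg_leM Hk; apply: tdeg_le_coefC.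
  suff -> : t`_k = 0 by rewrite mul0r => i j _; rewrite !coef0.
  by apply/polyP => j; rewrite tm ?coef0 // ltn_addr.
apply/leq_sizeP => j kj; rewrite coefB coefCM.
case: (ltngtP k j) kj => // [kj _|<- _].
  rewrite [t`_j]nth_default ?(leq_trans st) //.
  by rewrite [H`_j]nth_default ?sH // mulr0 subrr.
by move: Hmon; rewrite monicE lead_coefE sH => /eqP->; rewrite mulr1 subrr.
Qed.

(* [G] consists of directions not determined by [U]: above each of them the
   Redei polynomial of [U] divides ['X^q - 'X]. *)
Lemma redei_lacunary (F : finFieldType) (U : {set F * F}) (G : {set F}) :
  (1 < #|U|)%N -> (#|G| < #|F|)%N ->
  (forall y, y \in G -> {in U &, injective (fun u => u.2 - u.1 * y)}) ->
  exists2 g : {poly F}, (size g <= (#|F| - #|G|).+1)%N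
    & \prod_(u in U) ('X - u.2%:P) %| 'X^#|F| - g.
Proof.
move=> U1 GF Ginj.
pose H : {poly {poly F}} := \prod_(u <- enum U) ('X - (u.2%:P - u.1 *: 'X)%:P).
have sH : size H = #|U|.+1 by rewrite size_prod_XsubC -cardE.
have Hmon : H \is monic by apply: monic_prod_XsubC.
have Hdeg : tdeg_le #|U| H by rewrite cardE; apply: tdeg_le_prod_XsubC.
have [r [rq rk] [h hr]] := Xn_rem_tdeg_le #|F| Hmon sH Hdeg (ltnW U1).
have evH y : map_poly (horner_eval y) H
    = \prod_(u <- enum U) ('X - (u.2 - u.1 * y)%:P).
  rewrite map_prod_XsubC; apply: eq_bigr => u _.
  by rewrite /= /horner_eval hornerD hornerN hornerZ hornerC hornerX.
have evr y : 'X^#|F| = map_poly (horner_eval y) h * map_poly (horner_eval y) H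
    + map_poly (horner_eval y) r.
  by rewrite -rmorphM -rmorphD -hr; rewrite rmorphXn /= map_polyX.
(* The witness is the remainder specialised at direction 0, where [H] becomes the product over
   second coordinates. *)
exists (map_poly (horner_eval 0) r); last first.
  rewrite {1}(evr 0) addrK dvdp_mull // evH big_enum.
  by under [X in _ %| X]eq_bigr do rewrite mulr0 subr0.
(* Above [y] in [G], [H] has [#|U|] distinct roots in [F], so it divides ['X^#|F| - 'X] and hence
   the specialised [r] minus ['X], whose degree is smaller than [#|U|]. *)
have rG y : y \in G -> map_poly (horner_eval y) r = 'X.
  move=> yG; apply/eqP; rewrite -subr_eq0; apply/negPn/negP => r0.
  have : map_poly (horner_eval y) H %| map_poly (horner_eval y) r - 'X.
    have -> : map_poly (horner_eval y) r - 'X = ('X^#|F| - 'X)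
        - map_poly (horner_eval y) h * map_poly (horner_eval y) H.
      by rewrite {1}(evr y); ring.
    rewrite dvdp_sub ?dvdp_mull // evH -(big_map _ predT (fun z => 'X - z%:P)).
    apply: uniq_roots_dvdp.
      by apply/allP => x _; rewrite rootE !hornerE expf_card subrr.
    rewrite uniq_rootsE map_inj_in_uniq ?enum_uniq // => u v.
    by rewrite !mem_enum; apply: Ginj.
  move/(dvdp_leq r0); rewrite leqNgt evH size_prod_XsubC -cardE ltnS.
  rewrite (leq_trans (size_polyD _ _)) // geq_max size_polyN size_polyX U1 andbT.
  by apply/leq_sizeP => j kj; rewrite coef_map /= (nth_default _ (leq_trans rk kj)) raddf0.
apply/leq_sizeP => j jG; rewrite coef_map /=.
(* Here [2 <= j], so the coefficient vanishes on all of [G], while its degree in the direction is at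
   most [#|F| - j < #|G|]. *)
suff -> : r`_j = 0 by rewrite raddf0.
apply/eqP/negPn/negP => rj0.
have /max_poly_roots : all (root r`_j) (enum G).
  apply/allP => y; rewrite mem_enum => yG; rewrite rootE.
  have := congr1 (fun P : {poly F} => P`_j) (rG y yG).
  rewrite coef_map /= /horner_eval => ->; rewrite coefX.
  by case: j jG {rj0} => [|[|j]] //; lia.
move=> /(_ rj0 (enum_uniq _)); rewrite -cardE ltnNge => /negP; apply.
by apply/leq_sizeP => i iG; apply: rq; lia.
Qed.

(** * From a clique to numerical inequalities *)

Lemma clique_descent (F : finFieldType) (p t : nat) (S C : {set F}) :
  prime p -> #|F| = (p ^ t)%N -> S \subset nonzero_set F ->
  ratio_set S != nonzero_set F -> is_clique (cayley S) C -> (1 < #|C|)%N ->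
  (#|C| * #|C| <= #|F|)%N /\
  exists e, [/\ (e < t)%N, (#|C| <= p ^ (t - e))%N
    & (#|C| * (#|C| - p ^ e) + p ^ e <= #|ratio_set S|.+1)%N].
Proof.
move=> pp cF S0 SF Ccl C1; have pF := card_finPcharP cF pp.
pose G := ~: (0 |: ratio_set S).
have NF := card_ratio_set_lt S0 SF.
have R0 : 0 \notin ratio_set S.
  apply/negP => /imset2P[a b] /(subsetP S0) + /(subsetP S0); rewrite !inE.
  by move=> a0 b0 /esym/eqP; rewrite mulf_eq0 invr_eq0 (negPf a0) (negPf b0).
have cG : (#|F| - #|G|)%N = #|ratio_set S|.+1.
  by have := cardsC (0 |: ratio_set S); rewrite cardsU1 R0 -/G add1n => <-; rewrite addnK.
have CS x y : x \in C -> y \in C -> x != y -> x - y \in S.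
  by move=> xC yC; move/forall_inP/(_ x xC)/forall_inP/(_ y yC)/implyP: Ccl.
have U1 : (1 < #|setX C C|)%N by rewrite cardsX; nia.
have GF : (#|G| < #|F|)%N by lia.
(* A collision of two distinct pairs makes [y] a quotient of differences of elements of [C], hence 0
   or an element of [ratio_set S]. *)
have Ginj y : y \in G -> {in setX C C &, injective (fun u => u.2 - u.1 * y)}.
  rewrite !inE negb_or => /andP[y0 yR] [a b] [c d] /=; rewrite !inE /=.
  move=> /andP[aC bC] /andP[cC dC] /eqP.
  have [<-|ac] := eqVneq a c; first by rewrite (inj_eq (addIr _)) => /eqP->.
  move/eqP => bd; have ybd : (a - c) * y = b - d.
    by rewrite (_ : b = d - c * y + a * y); [ring | rewrite -bd subrK].
  have ac0 : a - c != 0 by rewrite subr_eq0.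
  have bd0 : b != d.
    by rewrite -subr_eq0 -ybd mulf_neq0.
  case/negP: yR; apply/imset2P; exists (b - d) (a - c); rewrite ?CS //.
  by rewrite -ybd mulrC mulKf.
have [g gs gd] := redei_lacunary U1 GF Ginj.
rewrite cG in gs.
(* Each second coordinate occurs [#|C|] times, which is where the high multiplicity comes from. *)
have gprod : \prod_(u in setX C C) ('X - u.2%:P)
    = (\prod_(b <- enum C) ('X - b%:P)) ^+ #|C| :> {poly F}.
  under eq_bigl => u do rewrite inE.
  rewrite -(pair_big (mem C) (mem C) (fun _ b => 'X - b%:P)) /= prodr_const.
  by rewrite big_enum.
rewrite gprod in gd.
have C0 := ltnW C1.
have gF : (size g <= #|F|)%N by rewrite (leq_trans gs).
have sQ : size ('X^#|F| - g) = #|F|.+1.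
  by rewrite size_polyDl ?size_polyXn // size_polyN ltnS.
have Q0 : 'X^#|F| - g != 0 by rewrite -size_poly_gt0 sQ.
have gd' x : x \in enum C -> ('X - x%:P) ^+ #|C| %| 'X^#|F| - g.
  move=> xC; apply: dvdp_trans gd; apply: dvdp_exp2r.
  by rewrite (big_rem x xC) dvdp_mulr.
split.
  by have := leq_size_prod_exp (enum_uniq _) Q0 gd'; rewrite sQ -cardE ltnS.
rewrite cF in gd' NF.
rewrite {1 2}cardE; apply: Xpow_sub_descent gd' => //; rewrite -?cardE ?enum_uniq //.
Qed.

(** * Arithmetic of the bound and conclusion *)

Lemma sqr_sub_pred_lt (n N E P : nat) :
  (n * (n - E) + E <= N.+1)%N -> (E <= P)%N -> (2 < P)%N -> (P < n)%N ->
  ((n - (P - 1)) ^ 2 < N)%N.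
Proof.
move=> nE EP P3 Pn.
(* The expression equals [n ^ 2 - (n - 1) * E], which decreases in [E], so [E] may be replaced by
   [P]. *)
have mono : (n * (n - P) + P <= n * (n - E) + E)%N.
  rewrite -(subnK EP); set d := (P - E)%N.
  have -> : (n - E = n - (d + E) + d)%N by lia.
  have : (d <= n * d)%N by rewrite leq_pmull; lia.
  rewrite mulnDr; lia.
have {}nE := leq_trans mono nE.
have -> : (n - (P - 1) = (n - P).+1)%N by lia.
move: nE; rewrite -{1}(subnKC (ltnW Pn)); set k := (n - P)%N.
(* With [n = P + k], [N] is at least [k ^ 2 + P * k + P - 1], which exceeds [(k + 1) ^ 2] once
   [3 <= P]. *)
have : (3 * k <= P * k)%N by rewrite leq_mul2r P3 orbT.
rewrite mulnDl -mulnn; lia.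
Qed.

Lemma ltr_natr_sqrt (R : rcfType) (n m N : nat) :
  (n < m)%N \/ ((n - m) ^ 2 < N)%N -> n%:R < Num.sqrt (N%:R : R) + m%:R.
Proof.
case=> [nm|nmN]; first by apply: ltr_wpDl; rewrite ?sqrtr_ge0 ?ltr_nat.
have : Num.sqrt (((n - m) ^ 2)%:R : R) < Num.sqrt N%:R.
  have N0 : (0 < N)%N by apply: leq_ltn_trans nmN.
  by rewrite ltr_sqrt ?ltr0n // ltr_nat.
rewrite natrX sqrtr_sqr ger0_norm ?ler0n // -(ltrD2r m%:R);
apply: Order.POrderTheory.le_lt_trans.
by rewrite -natrD ler_nat; lia.
Qed.

(** Translating by a vertex [c] of [C] sends the other vertices into [S]. *)
Lemma card_clique_le (F : finFieldType) (S C : {set F}) :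
  is_clique (cayley S) C -> (#|C| <= #|S|.+1)%N.
Proof.
move=> Ccl; have [->|[c cC]] := set_0Vmem C; first by rewrite cards0.
rewrite (cardsD1 c) cC add1n ltnS -(card_imset _ (addIr (- c))).
apply/subset_leq_card/subsetP => _ /imsetP[x + ->]; rewrite !inE => /andP[xc xC].
by move/forall_inP/(_ x xC)/forall_inP/(_ c cC)/implyP: Ccl; apply.
Qed.

Lemma clique_numberP (T : finType) (e : rel T) :
  exists2 C, is_clique e C & clique_number e = #|C|.
Proof.
have [|C Ccl maxC] := @eq_bigmax_cond _ (mem (is_clique e)) (fun C => #|C|).
  by apply/card_gt0P; exists set0; apply/forall_inP => x; rewrite inE.
by exists C.
Qed.

(* The last premise of each conclusion removes exactly the degenerate cases in
   which the strict inequality fails: S empty when q = p (1 < 0 + 1), and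
   #|S| <= 1 when q = 8 (1 < 0 + 2 - 1 or 2 < 1 + 2 - 1). *)
Theorem theorem1p2 (R : rcfType) (F : finFieldType) (p q r : nat)
    (S : {set F})
    (p_prime : prime p)
    (qE : q = (p ^ (2 * r + 1))%N)
    (cardF : #|F| = q)
    (S_nonzero : S \subset nonzero_set F)
    (S_sym : S = opp_set S)
    (S_ratio : ratio_set S != nonzero_set F) :
  (q = p -> S != set0 ->
     (clique_number (cayley S))%:R
       < Num.sqrt (#|ratio_set S|%:R : R) + 1) /\
  (q <> p -> (q = 8%N -> (1 < #|S|)%N) ->
     (clique_number (cayley S))%:R
       < Num.sqrt (#|ratio_set S|%:R : R) + Num.sqrt (q%:R / p%:R : R) - 1).
Proof.
have [C Ccl ->] := clique_numberP (cayley S).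
have p1 := prime_gt1 p_prime.
rewrite qE in cardF *; have descent := clique_descent p_prime cardF S_nonzero S_ratio Ccl.
have CS := card_clique_le Ccl.
have SN := fun S0 => card_ratio_set S0 S_nonzero.
split=> [q_p S0|q_p q8].
  apply: (@ltr_natr_sqrt _ _ 1); right; have := SN S0.
  have r0 : r = 0%N.
    by have/eqP := q_p; rewrite -{2}(expn1 p) eqn_exp2l //; lia.
  move: S0 descent; rewrite r0 -card_gt0; case: (ltnP 1 #|C|) => [C1|C1] S0; last first.
    by rewrite (eqP (_ : #|C| - 1 == 0)%N) //; lia.
  (* The exponent is 1, so [e = 0] and [n * (n - 1) <= N], which for [1 < n] is stronger than
     [(n - 1) ^ 2 < N]. *)
  move=> /(_ isT)[_ [[|e] [//]]] _ _; rewrite expn0.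
  by move: #|C| #|ratio_set S| C1 => [|[|n]] // N _; rewrite !subn1 /=; nia.
have r0 : (0 < r)%N by rewrite lt0n; apply/eqP => r0; apply: q_p; rewrite r0 expn1.
have -> : (p ^ (2 * r + 1))%:R / p%:R = (p ^ r)%:R ^+ 2 :> R.
  rewrite addn1 expnSr natrM mulfK -?natrX -?expnM 1?mulnC //.
  by rewrite pnatr_eq0 -lt0n ltnW.
rewrite sqrtr_sqr ger0_norm ?ler0n // -addrA.
have P0 : (0 < p ^ r)%N by rewrite expn_gt0 ltnW.
rewrite -(natrB _ P0); apply: ltr_natr_sqrt.
have P2 : (2 <= p ^ r)%N by apply: leq_trans (leq_pexp2l (ltnW p1) r0); rewrite expn1.
have P_eq2 : (p ^ r = 2 -> p ^ (2 * r + 1) = 8)%N.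
  move=> Pe; have p2 : p = 2%N.
    apply/eqP; rewrite eqn_leq p1 andbT -Pe -{1}(expn1 p) leq_exp2l //.
  by rewrite expnD [(2 * r)%N]mulnC expnM Pe p2.
(* If [#|C| <= p ^ r], the square to be bounded is 0 or 1, and [#|C| - 1 <= #|S| <= #|ratio_set S|]
   suffices; when [p ^ r = 2] the assumption for [q = 8] is used. *)
have [CP|PC] := leqP #|C| (p ^ r).
  have SN' : (#|S| <= #|ratio_set S|)%N.
    by have [->|/SN //] := eqVneq S set0; rewrite cards0.
  have PS : (p ^ r = 2 -> 1 < #|S|)%N by move/P_eq2/q8.
  move: (p ^ r)%N #|C| #|S| #|ratio_set S| CS CP P2 SN' PS => P n s N nsN nP P2 sN PS.
  have : (n - (P - 1) <= 1)%N by lia.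
  by case d: (n - (P - 1))%N => [|[|]] // _; rewrite ?exp0n ?exp1n //; lia.
have [Csq [e [et Ce eN]]] := descent (leq_trans P2 (ltnW PC)).
(* From [p ^ r < #|C| <= p ^ (2 * r + 1 - e)]. *)
have er : (e <= r)%N.
  have := leq_trans PC Ce; rewrite ltn_exp2l //; lia.
have eP : (p ^ e <= p ^ r)%N by rewrite leq_pexp2l // ltnW.
(* If [p ^ r = 2], then [q = 8], while [3 <= #|C|] and [#|C| ^ 2 <= q]. *)
have P3 : (2 < p ^ r)%N.
  rewrite ltn_neqAle P2 andbT eq_sym; apply/eqP => Pe.
  by rewrite Pe in PC; have := leq_trans (leq_mul PC PC) Csq; rewrite cardF P_eq2.
by right; apply: sqr_sub_pred_lt eN eP P3 PC.
Qed.
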